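(* Let $d=1$ and $S = [-1/2,+1/2]$. Then for every $\hat c \in \mathbb{R}$ and every $c\in\{-1,+1\}$, $\ell_{\mathrm{SPO}}(\hat c,c) = \mathbf{1}(\mathrm{sgn}(\hat c)\neq c)$, i.e., the SPO loss function exactly matches the 0-1 loss function associated with binary classification.
   Context: For $c\in\mathbb{R}$: $z^*(c) := \min_{w\in S} cw$ and $W^*(c) := \arg\min_{w\in S} cw$. The (unambiguous) SPO loss is $\ell_{\mathrm{SPO}}(\hat c,c) := \max_{w\in W^*(\hat c)} cw - z^*(c)$. Here $\mathrm{sgn}$ is the sign function with $\mathrm{sgn}(0)=0$, and $\mathbf{1}(\cdot)$ equals 1 if its argument is true and 0 otherwise. The 0-1 loss is 0 if the predicted value has the same sign as the true label and 1 otherwise. *)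

(* Defs.v *)
From HB Require Import structures.
From mathcomp Require Import all_boot all_order all_algebra.
From mathcomp Require Import all_classical all_reals.

Set Implicit Arguments.
Unset Strict Implicit.
Unset Printing Implicit Defensive.

Import Order.TTheory GRing.Theory Num.Theory.

Local Open Scope classical_set_scope.
Local Open Scope ring_scope.

Definition minima (R : realType) (A : set R) : set R := A `&` lbound A.

Definition maxima (R : realType) (A : set R) : set R := A `&` ubound A.

(* Unlike [inf] and [sup], these are attained values: they are the unique
   elements of [minima A] and [maxima A] whenever those sets are nonempty;
   otherwise they take the meaningless value 0. *)
Definition set_min (R : realType) (A : set R) : R := xget 0 (minima A).

Definition set_max (R : realType) (A : set R) : R := xget 0 (maxima A).

(* The values of the objective [w |-> c * w] on a set of decisions. *)
Definition values (R : realType) (c : R) (A : set R) : set R :=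
  [set c * w | w in A].

Definition z_star (R : realType) (S : set R) (c : R) : R :=
  set_min (values c S).

Definition W_star (R : realType) (S : set R) (c : R) : set R :=
  [set w | S w /\ forall v, S v -> c * w <= c * v].

(* Worst case over the optimal decisions for the predicted cost [chat],
   which need not be unique. *)
Definition spo_loss (R : realType) (S : set R) (chat c : R) : R :=
  set_max (values c (W_star S chat)) - z_star S c.

(* The minimum and the maximum occurring in [spo_loss S chat c] exist, so that
   the default value 0 of [set_min] and [set_max] is not used. *)
Definition spo_loss_defined (R : realType) (S : set R) (chat c : R) : Prop :=
  minima (values c S) !=set0 /\ maxima (values c (W_star S chat)) !=set0.

Definition zero_one_loss (R : realType) (chat c : R) : R :=
  if Num.sg chat == Num.sg c then 0 else 1.

(* Main.v *)
Require Import Defs.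
From mathcomp Require Import all_boot all_order all_algebra.
From mathcomp Require Import all_classical all_reals.
From mathcomp Require Import lra.

Import Order.TTheory GRing.Theory Num.Theory.

Local Open Scope classical_set_scope.
Local Open Scope ring_scope.

(** A linear objective on an interval is optimal only at the left end for a positive cost, only at
    the right end for a negative one, and everywhere for cost 0 ([W_star_gt0], [W_star_lt0],
    [W_star0]). With [c] equal to 1 or -1 the true optimum is -1/2. A prediction of the right sign
    picks the same endpoint, so the loss is 0; one of the wrong sign picks the other endpoint, of
    value 1/2, so the loss is 1. At [chat = 0] the worst case over all of [S] is again 1/2, which
    agrees with sgn(0) differing from [c]. *)

Lemma set_minE (R : realType) (A : set R) (m : R) : minima A m -> set_min A = m.
Proof.
move=> Am; apply: xget_unique => // x [Ax lbx]; case: Am => Am lbm.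
by apply/le_anti; rewrite lbx // lbm.
Qed.

Lemma set_maxE (R : realType) (A : set R) (m : R) : maxima A m -> set_max A = m.
Proof.
move=> Am; apply: xget_unique => // x [Ax ubx]; case: Am => Am ubm.
by apply/le_anti; rewrite ubx // ubm.
Qed.

Lemma maxima_set1 (R : realType) (x : R) : maxima [set x] x.
Proof. by split=> // y ->. Qed.

Lemma minima_values (R : realType) (A : set R) (a w : R) :
  W_star A a w -> minima (values a A) (a * w).
Proof.
by move=> [Aw wmin]; split=> [|_ [v Av <-]]; [exists w | exact: wmin].
Qed.

Lemma W_star0 (R : realType) (A : set R) : W_star A 0 = A.
Proof.
apply/seteqP; split=> [w []//|w Aw].
by split=> // v _; rewrite !mul0r.
Qed.

Lemma W_star_gt0 (R : realType) (A : set R) (a l : R) :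
  0 < a -> minima A l -> W_star A a = [set l].
Proof.
move=> a0 [Al lbl]; apply/seteqP; split=> [w [Aw wmin]|_ ->] /=.
  by apply/le_anti; rewrite lbl // andbT -(ler_pM2l a0) wmin.
by split=> // v Av; rewrite ler_pM2l// lbl.
Qed.

(** Cancelling the negative factor [a] reverses the order, so an optimal [w], compared with [r],
    satisfies [r <= w]. *)
Lemma W_star_lt0 (R : realType) (A : set R) (a r : R) :
  a < 0 -> maxima A r -> W_star A a = [set r].
Proof.
move=> a0 [Ar ubr]; apply/seteqP; split=> [w [Aw wmin]|_ ->] /=.
  by apply/le_anti; rewrite ubr //= -(ler_nM2l a0) wmin.
by split=> // v Av; rewrite ler_nM2l// ubr.
Qed.

(** Explicit witnesses settle both the existence of the two extrema and their values, so the default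
    0 never enters. *)
Lemma spo_lossE (R : realType) (A : set R) (chat c w m : R) :
    W_star A c w -> maxima (values c (W_star A chat)) m ->
  spo_loss_defined A chat c /\ spo_loss A chat c = m - c * w.
Proof.
move=> /minima_values cw maxm; split; first by split; [exists (c * w) | exists m].
by rewrite /spo_loss /z_star (set_minE _ _ _ cw) (set_maxE _ _ _ maxm).
Qed.

Theorem proposition1 (R : realType) (S : set R)
    (hS : S = [set w : R | - (1 / 2) <= w <= 1 / 2])
    (chat c : R) (hc : c = -1 \/ c = 1) :
  [/\ spo_loss_defined S chat c,
      spo_loss S chat c = (Num.sg chat != c)%:R
    & spo_loss S chat c = zero_one_loss chat c].
Proof.
have sgc : Num.sg c = c by case: hc => ->; rewrite ?sgrN sgr1.
(* A label is its own sign, so the test in [zero_one_loss] is the indicator itself. *)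
suff [Sdef ->] : spo_loss_defined S chat c /\
    spo_loss S chat c = (Num.sg chat != c)%:R.
  by split=> //; rewrite /zero_one_loss sgc; case: eqP.
have minS : minima S (- (1 / 2)).
  by rewrite hS; split=> [|w /andP[]//] /=; apply/andP; split; lra.
have maxS : maxima S (1 / 2).
  by rewrite hS; split=> [|w /andP[]//] /=; apply/andP; split; lra.
(* This is the endpoint whose sign is opposite to that of [c], written uniformly for both labels. *)
have cmin : W_star S c (- c / 2).
  case: hc => ->.
    by rewrite (W_star_lt0 _ _ _ _ _ maxS) ?ltrN10 //= opprK.
  by rewrite (W_star_gt0 _ _ _ _ _ minS) ?ltr01 //= mulNr.
have sqc : c * c = 1 by case: hc => ->; rewrite ?mulrNN mulr1.
have [chat0|chat0|->] := ltgtP chat 0.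
- have := maxima_set1 _ (c * (1 / 2)).
  (* Read backwards, the singleton becomes the set of values over the unique optimal decision for
     [chat]. *)
  rewrite -(image_set1 (fun w => c * w)) -(W_star_lt0 _ _ _ _ chat0 maxS).
  move=> /(spo_lossE _ _ _ _ _ _ cmin)[Sdef ->]; split=> //.
  by rewrite ltr0_sg //; case: hc => ->; case: eqP => /= ?; lra.
- have := maxima_set1 _ (c * - (1 / 2)).
  rewrite -(image_set1 (fun w => c * w)) -(W_star_gt0 _ _ _ _ chat0 minS).
  move=> /(spo_lossE _ _ _ _ _ _ cmin)[Sdef ->]; split=> //.
  by rewrite gtr0_sg //; case: hc => ->; case: eqP => /= ?; lra.
- have maxc : maxima (values c (W_star S 0)) (1 / 2).
    rewrite W_star0; split.
      (* The worst decision is the endpoint on the side of [c], where the value is [c * c / 2]. *)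
      exists (c / 2); last by rewrite mulrA sqc.
      by rewrite hS /=; apply/andP; case: hc => ->; split; lra.
    by rewrite hS => _ [w /andP[wl wr] <-]; case: hc => ->; lra.
  have [Sdef ->] := spo_lossE _ _ _ _ _ _ cmin maxc; split=> //.
  by rewrite sgr0; case: hc => ->; case: eqP => /= ?; lra.
Qed.
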